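(* Let $X$ be the Cantor set. If $G\le\mathrm{Homeo}(X)$ is a uniformly discrete ample group, then $G$ is residually finite.
   Context: For $G\le \mathrm{Homeo}(X)$, the piecewise full group $\mathbf{F}(G)$ consists of all $g\in\mathrm{Homeo}(X)$ for which there are a finite clopen partition $X=U_1\sqcup\dots\sqcup U_n$ and $g_1,\dots,g_n\in G$ with $g|_{U_i}=g_i|_{U_i}$; $G$ is piecewise full if $\mathbf{F}(G)=G$. $G$ is ample if it is piecewise full, locally finite (every finite subset lies in a finite subgroup), countable, and for every $g\in G$ the set $\mathrm{Fix}(g)$ of fixed points is clopen in $X$. $G$ is uniformly discrete if there is a (finite) clopen partition $\mathcal{P}$ of $X$ with $|Gx\cap U|\le1$ for all $x\in X$ and $U\in\mathcal{P}$. A group is residually finite if the intersection of all its finite-index subgroups is trivial. *)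

(* Defs.v *)
From HB Require Import structures.
From mathcomp Require Import all_boot.
From mathcomp Require Import all_classical topology cantor.

Set Implicit Arguments.
Unset Strict Implicit.
Unset Printing Implicit Defensive.

Local Open Scope classical_set_scope.
Local Open Scope group_scope.

(* The inverse is part of the data, but it is determined by the underlying map
   (see [homeoP]). *)
Record homeo (X : topologicalType) := Homeo {
  homeo_fun :> X -> X;
  homeo_inv : X -> X;
  homeo_funK : cancel homeo_fun homeo_inv;
  homeo_invK : cancel homeo_inv homeo_fun;
  homeo_continuous : continuous homeo_fun;
  homeo_inv_continuous : continuous homeo_inv }.

Section HomeoGroup.
Variable X : topologicalType.
Implicit Types f g h : homeo X.

Lemma homeoP f g : f =1 g -> f = g.
Proof.
case: f g => [f f' fK f'K cf cf'] [g g' gK g'K cg cg'] /= /funext fg.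
have fg' : f' = g'.
  by apply/funext => x; apply: (can_inj gK); rewrite g'K -fg f'K.
by subst g g'; congr Homeo; exact: Prop_irrelevance.
Qed.

HB.instance Definition _ := gen_eqMixin (homeo X).
HB.instance Definition _ := gen_choiceMixin (homeo X).

Definition homeo_one : homeo X :=
  @Homeo X id id (fun=> erefl) (fun=> erefl) (fun=> cvg_id) (fun=> cvg_id).

Lemma homeo_mul_continuous f g : continuous (f \o g).
Proof.
by move=> x; apply: continuous_comp; exact: homeo_continuous.
Qed.

Lemma homeo_mul_inv_continuous f g : continuous (homeo_inv g \o homeo_inv f).
Proof.
by move=> x; apply: continuous_comp; exact: homeo_inv_continuous.
Qed.

Definition homeo_mul f g : homeo X :=
  Homeo (can_comp (@homeo_funK X f) (@homeo_funK X g))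
        (can_comp (@homeo_invK X g) (@homeo_invK X f))
        (@homeo_mul_continuous f g) (@homeo_mul_inv_continuous f g).

Definition homeo_invg f : homeo X :=
  Homeo (@homeo_invK X f) (@homeo_funK X f)
        (@homeo_inv_continuous X f) (@homeo_continuous X f).

Lemma homeo_mulA : associative homeo_mul.
Proof. by move=> f g h; apply: homeoP. Qed.

Lemma homeo_mul1 : left_id homeo_one homeo_mul.
Proof. by move=> f; apply: homeoP. Qed.

Lemma homeo_mulr1 : right_id homeo_one homeo_mul.
Proof. by move=> f; apply: homeoP. Qed.

Lemma homeo_mulV : left_inverse homeo_one homeo_invg homeo_mul.
Proof. by move=> f; apply: homeoP => x /=; exact: homeo_funK. Qed.

Lemma homeo_mulrV : right_inverse homeo_one homeo_invg homeo_mul.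
Proof. by move=> f; apply: homeoP => x /=; exact: homeo_invK. Qed.

HB.instance Definition _ := isGroup.Build (homeo X)
  homeo_mulA homeo_mul1 homeo_mulr1 homeo_mulV homeo_mulrV.

End HomeoGroup.

Section SubgroupsOfAGroup.
Variable gT : groupType.
Implicit Types G H : set gT.

Definition subgroup H := group_closed [in H].

Definition subgroup_of G H := subgroup H /\ H `<=` G.

Definition left_coset (g : gT) H : set gT := [set g * h | h in H].

Definition finite_index G H := finite_set [set left_coset g H | g in G].

Definition residually_finite G :=
  \bigcap_(H in [set H | subgroup_of G H /\ finite_index G H]) H = [set 1].

Definition locally_finite G :=
  forall F : set gT, finite_set F -> F `<=` G ->
    exists H, [/\ subgroup_of G H, finite_set H & F `<=` H].

End SubgroupsOfAGroup.

Section HomeoSubgroups.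
Variable X : topologicalType.
Implicit Types G : set (homeo X).

Definition clopen_partition n (U : 'I_n -> set X) :=
  partition [set: 'I_n] U [set: X] /\ forall i, clopen (U i).

Definition full_group G : set (homeo X) :=
  [set g | exists n (U : 'I_n -> set X) (gs : 'I_n -> homeo X),
    [/\ clopen_partition U, forall i, G (gs i) &
        forall i x, U i x -> g x = gs i x]].

Definition piecewise_full G := full_group G = G.

Definition fixed_points (g : homeo X) : set X := [set x | g x = x].

Definition ample G :=
  [/\ piecewise_full G, locally_finite G, countable G &
      forall g, G g -> clopen (fixed_points g)].

Definition homeo_orbit G (x : X) : set X := [set g x | g in G].

Definition uniformly_discrete G :=
  exists n (U : 'I_n -> set X), clopen_partition U /\
    forall x i, is_subset1 (homeo_orbit G x `&` U i).

End HomeoSubgroups.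

(* Main.v *)
(* The orbits of a uniformly discrete group are finite, so every point stabilizer
   has finite index. An element lying in all of them fixes every point, so it is
   trivial. *)
Require Import Defs.
From mathcomp Require Import all_boot.
From mathcomp Require Import all_classical topology cantor.

(** A finite clopen partition whose parts each meet an orbit in at most one point bounds the size of
    that orbit by the number of parts ([uniformly_discrete_finite_orbit]). By orbit-stabilizer,
    stabilizers then have finite index ([point_stabilizer_finite_index]), and since homeomorphisms
    are determined by their values, the stabilizers intersect trivially. *)

Section SubgroupClosure.
Context {gT : groupType} {G : set gT}.
Local Open Scope group_scope.

Lemma subgroup_one : subgroup G -> G 1.
Proof. by case=> /set_mem. Qed.

Lemma subgroup_div g h : subgroup G -> G g -> G h -> G (g / h).
Proof.
by move=> [_ divG] Gg Gh; apply: set_mem; apply: divG; exact: mem_set.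
Qed.

Lemma subgroup_inv g : subgroup G -> G g -> G g^-1.
Proof.
by move=> sG Gg; rewrite -div1g; exact: subgroup_div sG (subgroup_one sG) Gg.
Qed.

Lemma subgroup_mul g h : subgroup G -> G g -> G h -> G (g * h).
Proof.
by move=> sG Gg Gh; rewrite -[h]invgK; apply: subgroup_div => //; exact: subgroup_inv.
Qed.

End SubgroupClosure.

Section PointStabilizers.
Context {X : topologicalType}.
Implicit Types (G : set (homeo X)) (x : X).
Local Open Scope classical_set_scope.
Local Open Scope group_scope.

Definition point_stabilizer G x : set (homeo X) := [set g | G g /\ g x = x].

Lemma point_stabilizer_subgroup G x :
  subgroup G -> subgroup_of G (point_stabilizer G x).
Proof.
move=> sG; split; last by move=> g [].
split; first by apply: mem_set; split => //; exact: subgroup_one.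
move=> g h /set_mem[Gg gx] /set_mem[Gh hx]; apply: mem_set; split.
  exact: subgroup_div.
(* As [h x = x], the right-hand [x] unfolds to [g x], then to [g] applied to the preimage of [h x],
   which is that of [x]. *)
by rewrite -[RHS]gx -[in RHS](homeo_funK h x) hx.
Qed.

(** The coset depends on [g] only through [g x], so cosets can be indexed by orbit points. *)
Lemma left_coset_point_stabilizer G g x : subgroup G -> G g ->
  left_coset g (point_stabilizer G x) = [set h | G h /\ h x = g x].
Proof.
move=> sG Gg; apply/seteqP; split=> h /=.
  by move=> [k [Gk kx] <-]; split; [exact: subgroup_mul | rewrite /= kx].
move=> [Gh hx]; exists (g^-1 * h); last by rewrite mulVKg.
split; first by apply: subgroup_mul => //; exact: subgroup_inv.
by rewrite /= hx homeo_funK.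
Qed.

Lemma point_stabilizer_finite_index G x : subgroup G ->
  finite_set (homeo_orbit G x) -> finite_index G (point_stabilizer G x).
Proof.
move=> sG /(finite_image (fun y => [set h : homeo X | G h /\ h x = y])).
apply: sub_finite_set => _ [g Gg <-].
by exists (g x); [exists g | rewrite left_coset_point_stabilizer].
Qed.

Lemma uniformly_discrete_finite_orbit G x :
  uniformly_discrete G -> finite_set (homeo_orbit G x).
Proof.
move=> [n [U [[[coverU _ _] _] U1]]].
rewrite -[homeo_orbit G x]setIT -coverU /cover setI_bigcupr.
apply: bigcup_finite => // i _.
(* A nonempty trace of the orbit on a part provides a point [y], and the trace lies in the singleton
   of [y]. *)
have [->|/set0P[y Uy]] := eqVneq (homeo_orbit G x `&` U i) set0.
  exact: finite_set0.
by apply: sub_finite_set (finite_set1 y) => z Uz; exact: U1 Uz Uy.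
Qed.

End PointStabilizers.

Theorem proposition3p5 (G : set (homeo cantor_space)) :
  subgroup G -> uniformly_discrete G -> ample G -> residually_finite G.
Proof.
move=> sG discreteG _; apply/seteqP; split=> [g fixg | _ -> H [[sH _] _]]; last first.
  exact: subgroup_one.
apply: homeoP => x.
have [] // : point_stabilizer G x g.
apply: fixg; split; first exact: point_stabilizer_subgroup.
apply: point_stabilizer_finite_index => //.
exact: uniformly_discrete_finite_orbit.
Qed.
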